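(* There exists a parameter value $\theta\in\mathbb{R}/\mathbb{Z}$ such that $\Phi(\theta)<\infty$, and $\Phi(\theta)$ is not computable by any Turing machine with an oracle for $\theta$; that is, there is no oracle Turing machine $M^\phi$ such that, for every oracle $\phi$ for $\theta$ and every $m\in\mathbb{N}$, $M^\phi(m)$ outputs a dyadic rational $y$ with $|y-\Phi(\theta)|<2^{-m}$.
   Context: Points of $\mathbb{R}/\mathbb{Z}$ are represented by numbers in $[0,1)$. Yoccoz's Brjuno function $\Phi$: for irrational $\theta\in(0,1)$ put $\theta_1=\theta$ and $\theta_{n+1}=\{1/\theta_n\}$ (fractional part), and $\Phi(\theta)=\sum_{n=1}^{\infty}\theta_1\theta_2\cdots\theta_{n-1}\log\frac{1}{\theta_n}\in(0,\infty]$ (the empty product being $1$); for rational $\theta$, $\Phi(\theta)=\infty$. A dyadic rational is a number of the form $p/2^m$ ($p\in\mathbb{Z}$, $m\in\mathbb{N}$); $\mathbb{D}$ is the set of dyadic rationals. An oracle for a real number $x$ is a function $\phi:\mathbb{N}\to\mathbb{D}$ with $|x-\phi(n)|<2^{-n}$ for all $n\in\mathbb{N}$. An oracle Turing machine $M^\phi$ is a Turing machine which at any step of its computation may query the value $\phi(n)$ for any $n$. *)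

(* Defs.v *)
(* Computability is formalized with deterministic two-tape oracle Turing
   machines (a work tape and a query tape), reals are an arbitrary [realType]. *)
From mathcomp Require Import all_boot all_order all_algebra.
From mathcomp Require Import boolp classical_sets reals ereal sequences exp.
From mathcomp Require Import topology normedtype.

Set Implicit Arguments.
Unset Strict Implicit.
Unset Printing Implicit Defensive.

Import Order.TTheory GRing.Theory Num.Theory.

Local Open Scope ring_scope.

Definition frac_part {R : realType} (x : R) : R := x - (Num.floor x)%:~R.

Definition gauss_map {R : realType} (x : R) : R := frac_part (x^-1).

(* Indices start at 0: [gauss_orbit theta n] is the textbook theta_{n+1}. *)
Definition gauss_orbit {R : realType} (theta : R) (n : nat) : R :=
  iter n gauss_map theta.

Definition brjuno_term {R : realType} (theta : R) (n : nat) : R :=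
  (\prod_(0 <= i < n) gauss_orbit theta i) * ln ((gauss_orbit theta n)^-1).

(* For theta irrational in (0, 1) all terms are positive, so the series always
   converges in the extended reals. *)
Definition Phi {R : realType} (theta : R) : \bar R :=
  if `[< @rational R theta >] then +oo%E
  else (\sum_(0 <= n <oo) (brjuno_term theta n)%:E)%E.

Definition is_dyadic (x : rat) : Prop :=
  exists (p : int) (m : nat), x = p%:~R / 2 ^+ m.

Definition is_oracle {R : realType} (phi : nat -> rat) (x : R) : Prop :=
  forall n : nat, is_dyadic (phi n) /\ `|x - ratr (phi n)| < 2 ^- n.

(* A dyadic number is written in lowest terms p / 2^m as the word
     sign of p, |p| in binary, separator, m in binary
   over the letters [Some b] (the bit b) and [None] (the separator). *)
Definition letter : Type := option bool.

(* Most significant bit first; 0 is written as the single digit 0. *)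
Definition binary (n : nat) : seq bool :=
  rev [seq odd (n %/ 2 ^ i)%N | i <- iota 0 (trunc_log 2 n).+1].

Definition encode_dyadic (x : rat) : seq letter :=
  Some (x < 0) :: map Some (binary `|numq x|%N)
    ++ None :: map Some (binary (logn 2 `|denq x|%N)).

(* Tape symbols of a machine with k auxiliary symbols: [None] is the blank,
   [Some (inl a)] the letter a, [Some (inr j)] an auxiliary symbol. *)
Definition symbol (k : nat) : Type := option (letter + 'I_k).

Definition of_letter {k : nat} (a : letter) : symbol k := Some (inl a).

Inductive move : Type := MoveLeft | Stay | MoveRight.

(* Two-way infinite tape: the first list is the part strictly to the left of
   the head, nearest cell first; the second list starts at the scanned cell;
   all the cells beyond either list are blank. *)
Definition tape (k : nat) : Type := (seq (symbol k) * seq (symbol k))%type.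

Definition scan {k : nat} (t : tape k) : symbol k := head None t.2.

Definition write_move {k : nat} (s : symbol k) (d : move) (t : tape k)
    : tape k :=
  let: (l, r) := t in
  match d with
  | MoveLeft => (behead l, head None l :: s :: behead r)
  | Stay => (l, s :: behead r)
  | MoveRight => (s :: l, behead r)
  end.

Definition tape_of_word {k : nat} (w : seq letter) : tape k :=
  ([::], map of_letter w).

(* The content of the tape from the head up to the first blank, excluded. *)
Definition tape_word {k : nat} (t : tape k) : seq (symbol k) :=
  take (find (pred1 None) t.2) t.2.

(* The machine input and the oracle queries are natural numbers in unary. *)
Definition unary (n : nat) : seq letter := nseq n (Some true).

(* The number of consecutive digits 1 from the head rightwards. *)
Definition tape_unary {k : nat} (t : tape k) : nat :=
  find (predC1 (of_letter (Some true))) t.2.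

(* [delta q a b] is the instruction followed in state q when a is scanned on
   the work tape and b on the query tape: the next state, then what is written
   and how the head moves on the work tape and on the query tape. *)
Record oracle_TM : Type := OracleTM {
  nstates : nat;
  nsyms : nat;
  start_state : 'I_nstates;
  query_state : 'I_nstates;
  answer_state : 'I_nstates;
  halt_state : 'I_nstates;
  delta : 'I_nstates -> symbol nsyms -> symbol nsyms ->
    'I_nstates * (symbol nsyms * move) * (symbol nsyms * move)
}.

Record config (M : oracle_TM) : Type := Config {
  state : 'I_(nstates M);
  work_tape : tape (nsyms M);
  query_tape : tape (nsyms M)
}.

(* In the query state, the number n read on the query tape is replaced in one
   step by the encoding of phi n, and the machine enters the answer state. *)
Definition step (M : oracle_TM) (phi : nat -> rat) (c : config M) : config M :=
  if state c == halt_state M then c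
  else if state c == query_state M then
    @Config M (answer_state M) (work_tape c)
      (tape_of_word (encode_dyadic (phi (tape_unary (query_tape c)))))
  else
    let: (q, (a, d), (b, e)) :=
      @delta M (state c) (scan (work_tape c)) (scan (query_tape c)) in
    @Config M q (write_move a d (work_tape c)) (write_move b e (query_tape c)).

Definition init_config (M : oracle_TM) (m : nat) : config M :=
  @Config M (start_state M) (tape_of_word (unary m)) (tape_of_word [::]).

(* On input m and with oracle phi, M halts with the dyadic y on its work tape *)
Definition outputs (M : oracle_TM) (phi : nat -> rat) (m : nat) (y : rat)
    : Prop :=
  is_dyadic y /\
  exists t : nat,
    let c := iter t (@step M phi) (init_config M m) in
    state c = halt_state M /\
    tape_word (work_tape c) = map of_letter (encode_dyadic y).

Definition computes_from_oracle {R : realType} (M : oracle_TM) (theta x : R)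
    : Prop :=
  forall phi : nat -> rat, is_oracle phi theta ->
  forall m : nat, exists y : rat,
    outputs M phi m y /\ `|ratr y - x| < 2 ^- m.

(* Main.v *)
(* The machines are countable, so it suffices to defeat them one at a time while
   shrinking a closed interval and lowering an upper bound c for Phi; the limit
   point keeps Phi <= c because the partial sums of the Brjuno series are
   continuous at irrational points.
   A machine halting with precision 2^-m at a point y has read finitely many
   oracle values, so it gives the same answer at all points close to y.  But
   every neighbourhood of y contains points z where Phi exceeds Phi(y) by a
   prescribed amount g, up to a constant factor: keep n continued fraction
   digits of y, then insert one digit N with log N of the order of
   g / (theta_1 ... theta_n).  The first n terms of the series at z are
   controlled by those at y thanks to the bounded distortion of the products
   theta_1 ... theta_i.  By lower semicontinuity Phi stays large near z, so the
   machine errs on a whole neighbourhood of z. *)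
Require Import Defs.
From mathcomp Require Import all_boot all_order all_algebra.
From mathcomp Require Import boolp classical_sets reals ereal sequences exp.
From mathcomp Require Import topology normedtype.
From mathcomp Require Import ring lra.
Set Implicit Arguments.
Unset Strict Implicit.
Unset Printing Implicit Defensive.
Import Order.TTheory GRing.Theory Num.Theory.
Import numFieldNormedType.Exports.
Local Open Scope classical_set_scope.
Local Open Scope ring_scope.

(** * The Gauss map, its orbit products and the partial sums of the Brjuno series *)

Section GaussMap.
Context {R : realType}.
Implicit Types x y t : R.

Definition irr01 x : Prop := 0 < x < 1 /\ ~ rational x.

Definition digit x : nat := `|Num.floor x^-1|%N.

Lemma invr_gt1_itv x : 0 < x < 1 -> 1 < x^-1.
Proof. by move=> /andP[x0 x1]; rewrite invf_gt1. Qed.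

Lemma digitE x : 0 < x < 1 -> ((digit x)%:Z = Num.floor x^-1).
Proof.
move=> hx; rewrite /digit gez0_abs// floor_ge0.
by have := invr_gt1_itv hx; lra.
Qed.

Lemma digit_gt0 x : 0 < x < 1 -> (0 < digit x)%N.
Proof.
move=> hx; rewrite -ltz_nat digitE// floor_gt0.
exact/ltW/invr_gt1_itv.
Qed.

Lemma invr_digit x : 0 < x < 1 -> x^-1 = (digit x)%:R + gauss_map x.
Proof.
move=> hx; rewrite /gauss_map /frac_part -(digitE hx) -pmulrn.
by rewrite addrC subrK.
Qed.

Lemma digitK x : 0 < x < 1 -> ((digit x)%:R + gauss_map x)^-1 = x.
Proof. by move=> hx; rewrite -invr_digit// invrK. Qed.

Lemma gauss_branchK (a : nat) y : 0 <= y < 1 -> gauss_map (a%:R + y)^-1 = y.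
Proof.
move=> hy; rewrite /gauss_map /frac_part invrK.
have -> : Num.floor (a%:R + y) = a.
  by apply: floor_def; rewrite intrD -pmulrn; move: hy; lra.
by rewrite -pmulrn addrC addKr.
Qed.

Lemma gauss_map_itv x : 0 <= gauss_map x < 1.
Proof.
have := floor_itv x^-1; rewrite /gauss_map /frac_part intrD; lra.
Qed.

Lemma rational_inv x : rational x -> rational x^-1.
Proof. by move=> [q _ <-]; exists q^-1 => //; rewrite fmorphV. Qed.

Lemma rational_addz (z : int) x : rational x -> rational (z%:~R + x).
Proof. by move=> [q _ <-]; exists (z%:~R + q) => //; rewrite rmorphD /= ratr_int. Qed.

Lemma irr01_branch (a : nat) y : (0 < a)%N -> irr01 y -> irr01 (a%:R + y)^-1.
Proof.
move=> a0 [/andP[y0 y1] iy].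
have a1 : (1 : R) <= a%:R by rewrite ler1n.
split.
  rewrite invr_gt0 invf_lt1; lra.
move=> /rational_inv; rewrite invrK => /(@rational_addz (- a%:Z)).
by rewrite mulrNz -pmulrn addKr.
Qed.

Lemma irr01_gauss x : irr01 x -> irr01 (gauss_map x).
Proof.
move=> [hx ix].
have ig : ~ rational (gauss_map x).
  move=> /(@rational_addz (digit x)%:Z).
  by rewrite -pmulrn -invr_digit// => /rational_inv; rewrite invrK.
split=> //; have /andP[g0 ->] := gauss_map_itv x; rewrite andbT lt_neqAle g0 andbT.
by apply: contra_notN ig => /eqP <-; exists 0; rewrite ?rmorph0.
Qed.

Lemma irr01_orbit x n : irr01 x -> irr01 (gauss_orbit x n).
Proof. by move=> hx; elim: n => //= n IH; exact: irr01_gauss. Qed.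

Lemma orbitS x n : gauss_orbit x n.+1 = gauss_orbit (gauss_map x) n.
Proof. exact: iterSr. Qed.

(** For irrational [x] in (0, 1) this is |q x - p|, where p/q is the continued fraction convergent
    of index n - 1. *)
Definition orbit_prod x n : R := \prod_(0 <= i < n) gauss_orbit x i.

Lemma orbit_prod0 x : orbit_prod x 0 = 1.
Proof. by rewrite /orbit_prod big_nil. Qed.

Lemma orbit_prodS x n : orbit_prod x n.+1 = x * orbit_prod (gauss_map x) n.
Proof.
rewrite /orbit_prod big_nat_recl//=; congr (_ * _).
by apply: eq_bigr => i _; rewrite -orbitS.
Qed.

Lemma orbit_prod_gt0 x n : irr01 x -> 0 < orbit_prod x n.
Proof.
by move=> hx; apply: prodr_gt0 => i _; have [/andP[]] := irr01_orbit i hx.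
Qed.

Definition brjuno_sum x n : R := \sum_(0 <= i < n) brjuno_term x i.

Lemma brjuno_termE x n :
  brjuno_term x n = orbit_prod x n * ln (gauss_orbit x n)^-1.
Proof. by []. Qed.

Lemma brjuno_term_ge0 x n : irr01 x -> 0 <= brjuno_term x n.
Proof.
move=> hx; rewrite brjuno_termE mulr_ge0 ?(ltW (orbit_prod_gt0 _ hx))//.
by apply: ln_ge0; have [/invr_gt1_itv/ltW] := irr01_orbit n hx.
Qed.

Lemma brjuno_termS x n : brjuno_term x n.+1 = x * brjuno_term (gauss_map x) n.
Proof. by rewrite !brjuno_termE orbit_prodS orbitS mulrA. Qed.

Lemma brjuno_sumS x n :
  brjuno_sum x n.+1 = ln x^-1 + x * brjuno_sum (gauss_map x) n.
Proof.
rewrite /brjuno_sum big_nat_recl//= brjuno_termE orbit_prod0 mul1r.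
by congr (_ + _); rewrite mulr_sumr; apply: eq_bigr => i _; rewrite brjuno_termS.
Qed.

Lemma brjuno_sumD x m n :
  brjuno_sum x (m + n) =
  brjuno_sum x m + orbit_prod x m * brjuno_sum (gauss_orbit x m) n.
Proof.
elim: m x => [|m IH] x.
  by rewrite orbit_prod0 mul1r /brjuno_sum big_nil add0r.
by rewrite addSn !brjuno_sumS IH orbit_prodS orbitS mulrDr addrA mulrA.
Qed.

Lemma brjuno_sum_ge0 x n : irr01 x -> 0 <= brjuno_sum x n.
Proof. by move=> hx; apply: sumr_ge0 => i _; exact: brjuno_term_ge0. Qed.

Lemma brjuno_sum_homo x m n : irr01 x ->
  (m <= n)%N -> brjuno_sum x m <= brjuno_sum x n.
Proof.
move=> hx /subnKC <-; rewrite brjuno_sumD lerDl mulr_ge0 ?(ltW (orbit_prod_gt0 _ hx))//.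
exact/brjuno_sum_ge0/irr01_orbit.
Qed.

(** With a the first digit and g the Gauss image, the product is g / (a + g), where a >= 1 > g. *)
Lemma mul_gauss_map_le x : irr01 x -> x * gauss_map x <= 2^-1.
Proof.
move=> [hx _]; have d1 : (1 : R) <= (digit x)%:R by rewrite ler1n digit_gt0.
have /andP[g0 g1] := gauss_map_itv x.
rewrite -[X in X * _](digitK hx) mulrC ler_pdivrMr; nra.
Qed.

(** Two consecutive orbit points multiply to at most 1/2, so a bound S for the sums two steps later
    gives 1 + x + S / 2 <= 2 + S / 2; the value 4 is the fixed point of this recursion. *)
Lemma sum_orbit_prod_le x n : irr01 x ->
  \sum_(0 <= i < n) orbit_prod x i <= 4.
Proof.
elim/ltn_ind: n x => -[|[|n]] IH x hx.
- by rewrite big_nil.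
- by rewrite big_nat1 orbit_prod0; lra.
have [/andP[x0 x1] _] := hx.
rewrite big_nat_recl// big_nat_recl//= orbit_prod0 orbit_prodS orbit_prod0.
under eq_bigr do rewrite !orbit_prodS mulrA.
rewrite -mulr_sumr.
have h2 := mul_gauss_map_le hx.
have hg := irr01_gauss hx; have hgg := irr01_gauss hg.
have [/andP[g0 g1] _] := hg.
have := IH n _ _ hgg; rewrite ltnW// => /(_ isT) hS.
have S0 : 0 <= \sum_(0 <= i < n) orbit_prod (gauss_map (gauss_map x)) i.
  by apply: sumr_ge0 => i _; exact/ltW/orbit_prod_gt0.
nra.
Qed.

End GaussMap.

(** * Changing the continued fraction from a given digit on; bounded distortion *)

Section Graft.
Context {R : realType}.
Implicit Types x y z : R.

(* The number whose first [n] continued fraction digits are those of [x] and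
   whose [n]-th Gauss iterate is [y]. *)
Fixpoint graft x n y : R :=
  if n is m.+1 then ((digit x)%:R + graft (gauss_map x) m y)^-1 else y.

Lemma irr01_graft x n y : irr01 x -> irr01 y -> irr01 (graft x n y).
Proof.
move=> + hy; elim: n x => //= n IH x hx.
apply: irr01_branch; first by have [/digit_gt0] := hx.
exact/IH/irr01_gauss.
Qed.

Lemma graftK x n : irr01 x -> graft x n (gauss_orbit x n) = x.
Proof.
elim: n x => // n IH x hx; rewrite orbitS /= IH ?digitK//; first by have [] := hx.
exact: irr01_gauss.
Qed.

Lemma graftD x m n y :
  graft x (m + n) y = graft x m (graft (gauss_orbit x m) n y).
Proof. by elim: m x => // m IH x; rewrite addSn orbitS /= IH. Qed.

Lemma gauss_graftS x n y : irr01 x -> irr01 y ->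
  gauss_map (graft x n.+1 y) = graft (gauss_map x) n y.
Proof.
move=> hx hy; rewrite /= gauss_branchK//.
by have [/andP[/ltW-> ->]] := irr01_graft n (irr01_gauss hx) hy.
Qed.

Lemma orbit_graft x n y : irr01 x -> irr01 y -> gauss_orbit (graft x n y) n = y.
Proof.
move=> + hy; elim: n x => // n IH x hx.
by rewrite orbitS gauss_graftS// IH//; exact: irr01_gauss.
Qed.

Lemma orbit_prod_graftS x n y : irr01 x -> irr01 y ->
  orbit_prod (graft x n.+1 y) n.+1 =
  graft x n.+1 y * orbit_prod (graft (gauss_map x) n y) n.
Proof. by move=> hx hy; rewrite orbit_prodS gauss_graftS. Qed.

(** The difference of two values of an inverse branch is the difference of the arguments times both
    values. One value supplies the next factor of the orbit product, the other is less than 1 and is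
    dropped. *)
Lemma graft_dist x n y z : irr01 x -> irr01 y -> irr01 z ->
  `|graft x n y - graft x n z| <= orbit_prod (graft x n y) n.
Proof.
move=> + hy hz; elim: n x => [|n IH] x hx.
  have [hy' _] := hy; have [hz' _] := hz; rewrite /= orbit_prod0 ler_norml; lra.
have hg := irr01_gauss hx; rewrite orbit_prod_graftS//=.
have /= := irr01_graft n.+1 hx hy; have /= := irr01_graft n.+1 hx hz.
have := IH _ hg.
have [/andP[]] := irr01_graft n hg hy; have [/andP[]] := irr01_graft n hg hz.
set u := graft _ n z; set v := graft _ n y => u0 u1 _ v0 v1 _ IHn.
have : (1 : R) <= (digit x)%:R by rewrite ler1n digit_gt0//; have [] := hx.
set a : R := (digit x)%:R => a1 [/andP[p0 p1] _] [/andP[q0 q1] _].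
have -> : (a + v)^-1 - (a + u)^-1 = (a + v)^-1 * (a + u)^-1 * (u - v).
  by field; apply/andP; split; lra.
rewrite !normrM (ger0_norm (ltW p0)) (ger0_norm (ltW q0)) -mulrA ler_pM2l//.
rewrite distrC; apply: le_trans IHn; rewrite ler_piMl//; exact: ltW.
Qed.

(* The second inequality only serves the induction: reciprocals of orbit
   products obey the recursion of continued fraction denominators, and the
   pair of inequalities is stable under it. *)
Lemma orbit_prod_graft_distortion_aux x n y z :
  irr01 x -> irr01 y -> irr01 z ->
  let u := graft x n.+1 y in let v := graft x n.+1 z in
  orbit_prod u n.+1 <= 2 * orbit_prod v n.+1 /\
  v * orbit_prod u n.+1 <= 2 * (u * orbit_prod v n.+1).
Proof.
move=> + hy hz; elim: n x => [|n IH] x hx.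
  cbv zeta; rewrite !orbit_prodS !orbit_prod0 !mulr1.
  have /= := irr01_graft 1 hx hy; have /= := irr01_graft 1 hx hz.
  have : (1 : R) <= (digit x)%:R by rewrite ler1n digit_gt0//; have [] := hx.
  have [hy' _] := hy; have [hz' _] := hz.
  set a : R := (digit x)%:R => a1 [/andP[p0 p1] _] [/andP[q0 q1] _].
  split; last by nra.
  rewrite -[_ * _^-1]invf_div lef_pV2 ?posrE; last 2 first.
  - lra.
  - rewrite divr_gt0; lra.
  - lra.
cbv zeta; rewrite (orbit_prod_graftS n.+1 hx hy) (orbit_prod_graftS n.+1 hx hz).
have hg := irr01_gauss hx.
have := IH _ hg; cbv zeta.
have [/andP[]] := irr01_graft n.+1 hg hy; have [/andP[]] := irr01_graft n.+1 hg hz.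
have := orbit_prod_gt0 n.+1 (irr01_graft n.+1 hg hy).
have := orbit_prod_gt0 n.+1 (irr01_graft n.+1 hg hz).
rewrite ![graft x n.+2 _]/= -![(digit (gauss_map x))%:R + _]/(_ + _).
rewrite -![((digit (gauss_map x))%:R + graft _ n _)^-1]/(graft (gauss_map x) n.+1 _).
set u := graft _ n.+1 z; set v := graft _ n.+1 y.
set P := orbit_prod v _; set Q := orbit_prod u _.
have : (1 : R) <= (digit x)%:R by rewrite ler1n digit_gt0//; have [] := hx.
set a : R := (digit x)%:R => a1 Q0 P0 u0 u1 _ v0 v1 _ [h1 h2].
have au : 0 < a + u by lra. have av : 0 < a + v by lra.
have c0 : 0 < (a + u)^-1 by rewrite invr_gt0.
have d0 : 0 < (a + v)^-1 by rewrite invr_gt0.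
(* The new second inequality is the old first one rescaled. The new first one, cleared of
   denominators, is [a] times the old first one plus the old second one. *)
split; last first.
  have : 0 <= (a + u)^-1 * (a + v)^-1 * (2 * Q - P).
    by rewrite !mulr_ge0 ?subr_ge0// ltW.
  lra.
rewrite ler_pdivrMl// mulrCA [_^-1 * Q]mulrC mulrA mulrA ler_pdivlMr//.
nra.
Qed.

Lemma orbit_prod_graft_distortion x n y z : irr01 x -> irr01 y -> irr01 z ->
  orbit_prod (graft x n y) n <= 2 * orbit_prod (graft x n z) n.
Proof.
case: n => [|n] hx hy hz; first by rewrite !orbit_prod0; lra.
by case: (orbit_prod_graft_distortion_aux n hx hy hz).
Qed.

Lemma ln2_le1 : ln (2 : R) <= 1.
Proof. by have -> : (2 : R) = 1 + 1 by []; apply: le_ln1Dx; lra. Qed.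

(** Grafting at [m + n.+1] keeps the digit that follows the first [m], so the reciprocals of the two
    [m]-th orbit points differ by a factor at most 2. This adds ln 2 <= 1 to the logarithm, and
    distortion doubles the product. *)
Lemma brjuno_term_graft x m n y : irr01 x -> irr01 y ->
  brjuno_term (graft x (m + n.+1) y) m <=
  2 * (brjuno_term x m + orbit_prod x m).
Proof.
move=> hx hy; have ho := irr01_orbit m hx.
rewrite graftD brjuno_termE orbit_graft//; last exact: irr01_graft.
set w := graft _ n.+1 y; have hw : irr01 w by exact: irr01_graft.
have := orbit_prod_graft_distortion m hx hw ho; rewrite graftK// => hP.
rewrite brjuno_termE -[X in _ * (_ + X)]mulr1 -mulrDr mulrA.
have [/andP[w0 w1] _] := hw.
apply: ler_pM => //.
- exact/ltW/orbit_prod_gt0/irr01_graft.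
- by rewrite ln_ge0// ltW// invr_gt1_itv// w0.
have [/andP[o0 o1] _] := ho; have ho' : 0 < gauss_orbit x m < 1 by rewrite o0.
rewrite (le_trans (y := ln (2 * (gauss_orbit x m)^-1)))//; last first.
  by rewrite lnM ?posrE ?invr_gt0// addrC lerD2l ln2_le1.
have o'0 : 0 < 2 * (gauss_orbit x m)^-1 by rewrite mulr_gt0 ?invr_gt0.
have w'0 : 0 < w^-1 by rewrite invr_gt0.
rewrite ler_ln//.
rewrite /w /= invrK invr_digit//.
have := digit_gt0 ho'; rewrite -(@ler1n R) => d1.
have [/andP[g0 g1] _] := irr01_graft n (irr01_gauss ho) hy.
have [/andP[k0 k1] _] := irr01_gauss ho.
nra.
Qed.

End Graft.

(** * Continuity of partial Brjuno sums at irrational points *)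

Section Continuity.
Context {R : realType}.
Implicit Types x : R.

(** Irrationality puts [x^-1] strictly between two integers, so the floor is constant nearby and the
    map is locally an inverse minus a constant. *)
Lemma gauss_map_continuous x : irr01 x -> {for x, continuous (@gauss_map R)}.
Proof.
move=> hx; have [hx' _] := hx; have [/andP[g0 g1] _] := irr01_gauss hx.
have x0 : x != 0 by move: hx'; lra.
have hi := invr_digit hx'.
have cV : y^-1 @[y --> x] --> x^-1 by exact: inv_continuous.
have nearE : \forall y \near x, y^-1 - (digit x)%:R = gauss_map y.
  have hn : \forall y \near x^-1, y \in `](digit x)%:R, (digit x).+1%:R[.
    apply: (@near_in_itvoo R (digit x)%:R (digit x).+1%:R).
    by rewrite in_itv/= hi -natr1; lra.
  have hn2 : \forall y \near x, y^-1 \in `](digit x)%:R, (digit x).+1%:R[.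
    exact: cV hn.
  near=> y; have : y^-1 \in `](digit x)%:R, (digit x).+1%:R[ by near: y.
  rewrite in_itv/= -natr1 => hy.
  have -> : gauss_map y = y^-1 - (Num.floor y^-1)%:~R by [].
  rewrite (_ : Num.floor y^-1 = digit x) -?pmulrn//.
  by apply: floor_def; rewrite intrD -pmulrn; case/andP: hy => /ltW -> ->.
rewrite /prop_for /continuous_at (_ : gauss_map x = x^-1 - (digit x)%:R); last first.
  by rewrite hi addrC addKr.
apply: cvg_trans; first exact: (near_eq_cvg nearE).
by apply: cvgB => //; exact: cvg_cst.
Unshelve. all: by end_near. Qed.

Lemma gauss_orbit_continuous x n : irr01 x ->
  {for x, continuous (fun t : R => gauss_orbit t n)}.
Proof.
move=> hx; elim: n => [|n IH]; first exact: cvg_id.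
apply: (@continuous_comp _ _ _ (fun t : R => gauss_orbit t n) gauss_map) => //.
exact/gauss_map_continuous/irr01_orbit.
Qed.

Lemma brjuno_sum_continuous x n : irr01 x ->
  {for x, continuous (fun t : R => brjuno_sum t n)}.
Proof.
move=> hx; have co i := @gauss_orbit_continuous x i hx.
have cp i : orbit_prod t i @[t --> x] --> orbit_prod x i.
  rewrite /orbit_prod; elim: i => [|i IH].
    by rewrite big_nil; under eq_fun do rewrite big_nil; exact: cvg_cst.
  rewrite big_nat_recr//=; under eq_fun do rewrite big_nat_recr//=.
  by apply: cvgM => //; exact: co.
have ct i : brjuno_term t i @[t --> x] --> brjuno_term x i.
  have [/andP[o0 _] _] := irr01_orbit i hx.
  have cV : (gauss_orbit t i)^-1 @[t --> x] --> (gauss_orbit x i)^-1.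
    by apply: cvgV; [rewrite gt_eqF|exact: co].
  have cl : ln (gauss_orbit t i)^-1 @[t --> x] --> ln (gauss_orbit x i)^-1.
    by apply: (cvg_comp _ _ cV); apply: continuous_ln; rewrite invr_gt0.
  exact: cvgM (cp i) cl.
rewrite /prop_for /continuous_at /brjuno_sum; elim: n => [|n IH].
  by rewrite big_nil; under eq_fun do rewrite big_nil; exact: cvg_cst.
rewrite big_nat_recr//=; under eq_fun do rewrite big_nat_recr//=.
by apply: cvgD => //; exact: ct.
Qed.

Lemma brjuno_sum_near x n (e : R) : irr01 x -> 0 < e ->
  exists2 d : R, 0 < d & forall t, `|x - t| < d ->
    `|brjuno_sum x n - brjuno_sum t n| < e.
Proof.
move=> hx e0; have /cvgrPdist_lt/(_ e e0) := brjuno_sum_continuous hx (n := n).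
by rewrite -nbhs_ballE => -[d /= d0 hd]; exists d => // t ht; exact: hd.
Qed.

End Continuity.

(** * Raising the Brjuno function by a controlled amount near any point *)

Section Jump.
Context {R : realType}.
Implicit Types x y c : R.

Lemma irr01_PhiE x : irr01 x ->
  Phi x = (\sum_(0 <= n <oo) (brjuno_term x n)%:E)%E.
Proof. by move=> [_ ix]; rewrite /Phi; case: asboolP. Qed.

Lemma brjuno_sum_le_Phi x n : irr01 x -> ((brjuno_sum x n)%:E <= Phi x)%E.
Proof.
move=> hx; rewrite irr01_PhiE// /brjuno_sum -sumEFin.
by apply: nneseries_lim_ge => i _; rewrite lee_fin brjuno_term_ge0.
Qed.

Lemma Phi_le x c : irr01 x -> (forall n, brjuno_sum x n <= c) ->
  (Phi x <= c%:E)%E.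
Proof.
move=> hx hc; rewrite irr01_PhiE//; apply: lime_le.
  by apply: is_cvg_nneseries => i _ _; rewrite lee_fin brjuno_term_ge0.
by apply: nearW => n; rewrite sumEFin lee_fin; exact: hc.
Qed.

Lemma fine_PhiK x : irr01 x -> (Phi x < +oo)%E -> (fine (Phi x))%:E = Phi x.
Proof.
move=> hx fx; rewrite fineK// ge0_fin_numE//.
by rewrite (le_trans _ (brjuno_sum_le_Phi 0 hx))// /brjuno_sum big_nil.
Qed.

Lemma brjuno_sum_le_fine x n : irr01 x -> (Phi x < +oo)%E ->
  brjuno_sum x n <= fine (Phi x).
Proof. by move=> hx fx; rewrite -lee_fin fine_PhiK// brjuno_sum_le_Phi. Qed.

Lemma fine_Phi_le x c : irr01 x -> (forall n, brjuno_sum x n <= c) ->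
  (Phi x < +oo)%E /\ fine (Phi x) <= c.
Proof.
move=> hx /(Phi_le hx) hc; have fx := le_lt_trans hc (ltry c).
by split=> //; rewrite -lee_fin fine_PhiK.
Qed.

Lemma brjuno_sum_gt_fine x (e : R) : irr01 x -> (Phi x < +oo)%E -> 0 < e ->
  exists n, fine (Phi x) - e < brjuno_sum x n.
Proof.
move=> hx fx e0; apply: contrapT => /forallNP h.
have [] := @fine_Phi_le x (fine (Phi x) - e) hx; last by lra.
by move=> n; rewrite leNgt; apply/negP/h.
Qed.

Lemma nonneg_sum_tail (h : nat -> R) (b e : R) : (forall i, 0 <= h i) ->
  (forall n, \sum_(0 <= i < n) h i <= b) -> 0 < e ->
  exists K, forall k n, (K <= k)%N -> \sum_(k <= i < n) h i <= e.
Proof.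
move=> h0 hb e0; pose A := range (fun n => \sum_(0 <= i < n) h i).
have supA : has_sup A.
  split; first by exists 0; exists 0%N => //; rewrite big_nil.
  by exists b => _ [n _ <-].
have [_ [K _ <-] hK] := sup_adherent e0 supA.
exists K => k n Kk; have [nk|/ltnW kn] := leqP n k; first by rewrite big_geq// ltW.
have : \sum_(0 <= i < n) h i <= sup A by apply: sup_ubound; [case: supA|exists n].
have : 0 <= \sum_(K <= i < k) h i by apply: sumr_ge0.
rewrite (big_cat_nat (n := k) (leq0n _) kn)//= (big_cat_nat (n := K) (leq0n _) Kk)/=.
lra.
Qed.

Lemma orbit_prod_small x (e : R) : irr01 x -> 0 < e ->
  exists K, forall n, (K <= n)%N -> orbit_prod x n <= e.
Proof.
move=> hx e0.
have P0 i : 0 <= orbit_prod x i by exact/ltW/orbit_prod_gt0.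
have [K hK] := nonneg_sum_tail P0 (fun n => sum_orbit_prod_le n hx) e0.
by exists K => n Kn; have := hK n n.+1 Kn; rewrite big_nat1.
Qed.

(** The orbit products are summed along with the terms because both occur in the bound of
    [brjuno_term_graft]. *)
Lemma brjuno_tail x (e : R) : irr01 x -> (Phi x < +oo)%E -> 0 < e ->
  exists K, forall k n, (K <= k)%N ->
    \sum_(k <= i < n) (brjuno_term x i + orbit_prod x i) <= e.
Proof.
move=> hx fx; apply: (@nonneg_sum_tail _ (fine (Phi x) + 4)) => [i|n].
  by rewrite addr_ge0 ?brjuno_term_ge0// ltW// orbit_prod_gt0.
by rewrite big_split/= lerD ?sum_orbit_prod_le//; exact: brjuno_sum_le_fine.
Qed.

Lemma brjuno_sum_graft_le x y k n : irr01 x -> irr01 y -> (k <= n)%N ->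
  brjuno_sum (graft x n y) n <= brjuno_sum (graft x n y) k +
    2 * \sum_(k <= i < n) (brjuno_term x i + orbit_prod x i).
Proof.
move=> hx hy kn; rewrite {1}/brjuno_sum (big_cat_nat (n := k) (leq0n _) kn)//= lerD2l.
rewrite mulr_sumr; apply: ler_sum_nat => i /andP[_ /subnKC iN].
by have := brjuno_term_graft i (n - i.+1) hx hy; rewrite addnS -addSn iN.
Qed.

(** Taking N just above exp L keeps N + t between exp L and 3 exp L, and ln 3 <= 2. The error 2 does
    not depend on [L], so a small orbit product absorbs it. *)
Lemma nat_near_expR (L : R) : 0 <= L ->
  exists2 N : nat, (0 < N)%N &
    forall t, 0 < t < 1 -> L <= ln (N%:R + t) <= L + 2.
Proof.
move=> L0; exists (Num.truncn (expR L)).+1 => // t ht.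
have e1 : 1 <= expR L by rewrite -expR0 ler_expR.
have h1 := truncnS_gt (expR L).
have h2 : (Num.truncn (expR L))%:R <= expR L by rewrite truncn_le ltW// expR_gt0.
have t0 : 0 < (Num.truncn (expR L)).+1%:R + t by move: ht; lra.
apply/andP; split.
  by rewrite -[X in X <= _]expRK ler_ln ?posrE ?expR_gt0//; move: ht; lra.
have : ln ((Num.truncn (expR L)).+1%:R + t) <= ln (3 * expR L).
  by rewrite ler_ln ?posrE// -?natr1; [move: ht; lra|lra].
have : ln (3 : R) <= 2.
  by rewrite (_ : (3 : R) = 1 + 2); [apply: le_ln1Dx|]; lra.
rewrite lnM ?posrE ?expR_gt0// expRK; lra.
Qed.

Lemma Phi_jump x (g d : R) : irr01 x -> (Phi x < +oo)%E -> 0 < g -> 0 < d ->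
  exists y, [/\ irr01 y, `|x - y| < d,
    exists n, fine (Phi x) + g / 16 < brjuno_sum y n,
    (Phi y < +oo)%E & fine (Phi y) < fine (Phi x) + g].
Proof.
move=> hx fx g0 d0; set V := fine (Phi x).
have V0 : 0 <= V by apply: le_trans (brjuno_sum_le_fine 0 hx fx); rewrite /brjuno_sum big_nil.
have e0 : 0 < g / 100 by lra.
have [K1 hK1] := brjuno_sum_gt_fine hx fx e0.
have [K2 hK2] := brjuno_tail hx fx e0.
set K := maxn K1 K2.
have {}hK1 : V - g / 100 < brjuno_sum x K.
  by apply: lt_le_trans hK1 _; rewrite brjuno_sum_homo// leq_maxl.
have {}hK2 n : \sum_(K <= i < n) (brjuno_term x i + orbit_prod x i) <= g / 100.
  exact/hK2/leq_maxr.
have [d' d'0 hd'] := brjuno_sum_near K hx e0.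
(* An orbit product P <= [p0] puts the graft within [d] and [d'] of [x], and gives P (V + 2) <= g /
   200, which makes the rounding of the logarithm and the Brjuno sum of the new tail negligible. *)
pose p0 := Num.min (Num.min d d' / 2) (g / (200 * (V + 2))).
have p00 : 0 < p0.
  by rewrite !lt_min; apply/andP; split; [rewrite divr_gt0 ?lt_min ?d0|rewrite divr_gt0//; lra].
have [K3 hK3] := orbit_prod_small hx p00.
pose n := maxn K K3; have Kn : (K <= n)%N by exact: leq_maxl.
have := hK3 n (leq_maxr _ _); set P := orbit_prod x n.
have P0 : 0 < P by exact: orbit_prod_gt0.
rewrite le_min => /andP[hPd]; rewrite ler_pdivlMr ?mulr_gt0//; last by lra.
move=> hPV.
have [hPd1 hPd2] : P < d /\ P < d'.
  have m0 : 0 < Num.min d d' by rewrite lt_min d0.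
  have : P < Num.min d d' by lra.
  by rewrite lt_min => /andP.
(* With this logarithm the inserted digit contributes about g / 4, hence between g / 8 and g / 2
   after distortion by a factor 2, up to the small errors. *)
have L0 : 0 <= g / (4 * P) by rewrite divr_ge0//; lra.
have PL : P * (g / (4 * P)) = g / 4 by field; rewrite gt_eqF.
have [N N0 hN] := nat_near_expR L0.
have [x01 _] := hx; have /andP[lN uN] := hN _ x01.
(* After the digit N the expansion restarts with that of [x] itself, so the new tail has Brjuno sums
   at most V. *)
pose z := (N%:R + x)^-1; have hz : irr01 z by exact: irr01_branch.
have [/andP[z0 z1] _] := hz.
pose y := graft x n z; have hy : irr01 y by exact: irr01_graft.
have ho := irr01_orbit n hx.
have xy : `|x - y| <= P.
  by have := graft_dist n hx ho hz; rewrite graftK.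
have hP1 := orbit_prod_graft_distortion n hx hz ho.
have hP2 := orbit_prod_graft_distortion n hx ho hz.
rewrite graftK// -/P in hP1 hP2.
have Py0 : 0 < orbit_prod y n by exact: orbit_prod_gt0.
have yK : `|brjuno_sum x K - brjuno_sum y K| < g / 100.
  by apply: hd'; apply: le_lt_trans xy _.
have sumy m : brjuno_sum y (n + m.+1) =
    brjuno_sum y n + orbit_prod y n * (ln (N%:R + x) + z * brjuno_sum x m).
  rewrite brjuno_sumD orbit_graft// brjuno_sumS invrK gauss_branchK//.
  by case/andP: x01 => /ltW -> ->.
have yn : brjuno_sum y n <= brjuno_sum y K + 2 * (g / 100).
  by apply: le_trans (brjuno_sum_graft_le hx hz Kn) _; rewrite lerD2l ler_pM2l.
have yKn := brjuno_sum_homo hy Kn.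
have xK := brjuno_sum_le_fine K hx fx.
rewrite -/V in xK; rewrite ltr_norml in yK.
(* The increase is at most 3g/100 before the inserted digit and g/2 + g/100 from it on; 9/10 leaves
   ample room below g. *)
have [] := @fine_Phi_le y (V + 9 / 10 * g) hy.
  move=> m; apply: (le_trans (y := brjuno_sum y (n + m.+1))).
    by rewrite brjuno_sum_homo// (leq_trans (leqnSn m))// leq_addl.
  rewrite sumy; have := brjuno_sum_le_fine m hx fx; rewrite -/V.
  have := brjuno_sum_ge0 m hx; set s := brjuno_sum x m => s0 sV.
  have zs : z * s <= V by nra.
  have zs0 : 0 <= z * s by nra.
  have : orbit_prod y n * (ln (N%:R + x) + z * s) <=
         2 * P * (g / (4 * P) + 2 + V).
    apply: ler_pM; lra.
  move: yK; nra.
move=> fy Vy; exists y; split => //; [exact: le_lt_trans xy _| |lra].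
(* Stopping right after the inserted digit already gives more than V - g/50 + g/8, which exceeds V +
   g/16. *)
exists (n + 1)%N; rewrite sumy {2}/brjuno_sum big_nil mulr0 addr0.
have : P * (g / (4 * P)) <= 2 * (orbit_prod y n * ln (N%:R + x)).
  by rewrite [leRHS]mulrA; apply: ler_pM => //; exact: ltW.
move: yK; lra.
Qed.

End Jump.

(** * Determinism of oracle machines and their finite use of the oracle *)

Section Machines.
Implicit Types (M : oracle_TM) (phi : nat -> rat) (m n : nat).

Lemma eq_bits k m n : (m < 2 ^ k)%N -> (n < 2 ^ k)%N ->
  (forall i, (i < k)%N -> odd (m %/ 2 ^ i)%N = odd (n %/ 2 ^ i)%N) -> m = n.
Proof.
elim: k m n => [|k IH] m n; first by rewrite expn0 !ltnS !leqn0 => /eqP-> /eqP->.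
rewrite expnS => hm hn h.
have h0 : odd m = odd n by have := h 0%N isT; rewrite expn0 !divn1.
have h1 : (m %/ 2 = n %/ 2)%N.
  apply: IH; rewrite ?ltn_divLR// 1?mulnC// => i ik.
  by have := h i.+1 ik; rewrite expnS !divnMA.
by rewrite -(odd_double_half m) -(odd_double_half n) -!divn2 h0 h1.
Qed.

Lemma binary_inj : injective binary.
Proof.
move=> m n /(can_inj revK) h.
have hk : (trunc_log 2 m).+1 = (trunc_log 2 n).+1.
  by have := congr1 size h; rewrite !size_map !size_iota.
have hlt p : (p < 2 ^ (trunc_log 2 p).+1)%N by exact: trunc_log_ltn.
apply: (@eq_bits (trunc_log 2 m).+1) => //; first by rewrite hk.
move=> i im; have := congr1 (nth false ^~ i) h.
by rewrite !(nth_map 0%N) ?size_iota -?hk// !nth_iota -?hk.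
Qed.

(** The digits before the separator are all [Some], so the first [None] marks the cut. *)
Lemma cat_None_inj (u u' : seq bool) (v v' : seq letter) :
  map Some u ++ None :: v = map Some u' ++ None :: v' -> u = u' /\ v = v'.
Proof.
elim: u u' => [|a u IH] [|a' u'] //=; first by case.
by move=> [-> /IH[-> ->]].
Qed.

(** The encoding keeps only the 2-adic valuation of the denominator; it recovers the denominator
    because that is a pure power of 2. *)
Lemma denq_dyadic (x : rat) : is_dyadic x ->
  exists k, `|denq x|%N = (2 ^ k)%N.
Proof.
move=> [p [m xE]].
have h : numq x * 2 ^+ m = p * denq x.
  apply: (@intr_inj rat); rewrite !rmorphM/= rmorphXn/= numqE {1}xE.
  by rewrite mulrAC divfK// expf_neq0.
have : (`|denq x| %| 2 ^ m)%N.
  have /(congr1 absz) := h; rewrite !abszM abszX => h'.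
  rewrite -(@Gauss_dvdr _ `|numq x|) 1?coprime_sym ?coprime_num_den//.
  by rewrite h' dvdn_mull.
by move=> /(dvdn_pfactor _ _ (isT : prime 2)) [k _ ->]; exists k.
Qed.

Lemma encode_dyadic_inj (x y : rat) : is_dyadic x -> is_dyadic y ->
  encode_dyadic x = encode_dyadic y -> x = y.
Proof.
move=> /denq_dyadic[k dx] /denq_dyadic[l dy]; rewrite /encode_dyadic dx dy.
rewrite !pfactorK// => -[hs] /cat_None_inj[/binary_inj hn].
move=> /(inj_map (@Some_inj _))/binary_inj hk.
have hd : denq x = denq y.
  by rewrite -(gtz0_abs (denq_gt0 x)) -(gtz0_abs (denq_gt0 y)) dx dy hk.
have hnum : numq x = numq y.
  rewrite [LHS]intEsign [RHS]intEsign hn.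
  by rewrite !numq_lt0 hs.
by rewrite -[x]divq_num_den -[y]divq_num_den hd hnum.
Qed.

Lemma run_local M phi t c : exists b, forall phi',
  (forall n, (n < b)%N -> phi' n = phi n) ->
  iter t (@step M phi') c = iter t (@step M phi) c.
Proof.
elim: t => [|t [b IH]]; first by exists 0%N.
pose c' := iter t (@step M phi) c.
(* The next step can consult the oracle only at the number on the query tape of [c']; including it
   is harmless if no query occurs. *)
exists (maxn b (tape_unary (query_tape c')).+1) => phi' h.
rewrite !iterS IH => [|n nb]; last by rewrite h// leq_max nb.
by rewrite -/c' /step h// leq_max ltnSn orbT.
Qed.

Lemma outputs_local M phi m y : outputs M phi m y -> exists b, forall phi',
  (forall n, (n < b)%N -> phi' n = phi n) -> outputs M phi' m y.
Proof.
move=> [dy [t ht]]; have [b hb] := run_local phi t (init_config M m).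
by exists b => phi' /hb h; split=> //; exists t; rewrite h.
Qed.

Lemma step_halt M phi t c : state c = halt_state M ->
  iter t (@step M phi) c = c.
Proof. by move=> hc; elim: t => //= t ->; rewrite /step hc eqxx. Qed.

(** A halting configuration is fixed by [step], so two halting times show the same tape, and the
    encoding is injective on dyadics. *)
Lemma outputs_uniq M phi m y z : outputs M phi m y -> outputs M phi m z -> y = z.
Proof.
move=> [dy [t [ht ty]]] [dz [u [hu tz]]]; apply: encode_dyadic_inj => //.
have oinj : injective (@of_letter (nsyms M)) by move=> a b [].
apply: (inj_map oinj); rewrite -ty -tz.
clear -ht hu.
wlog tu : t u ht hu / (t <= u)%N.
  by move=> hw; case/orP: (leq_total t u) => [/hw|/hw->//]; exact.
by rewrite -(subnK tu) iterD (step_halt _ _ ht).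
Qed.

Context {R : realType}.
Implicit Types x t v : R.

Lemma dyadic_approx x n : exists q, is_dyadic q /\ `|x - ratr q| < 2 ^- n.
Proof.
exists ((Num.floor (x * 2 ^+ n))%:~R / 2 ^+ n); split.
  by exists (Num.floor (x * 2 ^+ n)), n.
have p0 : 0 < 2 ^+ n :> R by rewrite exprn_gt0.
rewrite fmorph_div/= rmorphXn/= ratr_int ratr_nat.
have -> : x - (Num.floor (x * 2 ^+ n))%:~R / 2 ^+ n =
    (x * 2 ^+ n - (Num.floor (x * 2 ^+ n))%:~R) / 2 ^+ n.
  by rewrite mulrBl mulfK ?gt_eqF.
rewrite normrM normfV (gtr0_norm p0) ltr_pdivrMr// mulVf ?gt_eqF//.
by have := floor_itv (x * 2 ^+ n); rewrite intrD ltr_norml; lra.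
Qed.

Lemma oracle_exists x : exists phi, is_oracle phi x.
Proof. by have [phi h] := choice (dyadic_approx x); exists phi. Qed.

(** The oracle inequalities are strict, so the first [b] of them share a positive slack [d]. The
    remaining values are taken from any oracle for [t]. *)
Lemma oracle_near phi x b : is_oracle phi x -> exists2 d : R, 0 < d &
  forall t, `|x - t| < d ->
  exists2 phi', is_oracle phi' t & forall n, (n < b)%N -> phi' n = phi n.
Proof.
move=> hphi.
have [d d0 hd] : exists2 d : R, 0 < d &
    forall n, (n < b)%N -> `|x - ratr (phi n)| + d <= 2 ^- n.
  elim: b => [|b [d d0 hd]]; first by exists 1.
  have [_] := hphi b; rewrite -subr_gt0; set r := _ - _ => r0.
  exists (Num.min d r); first by rewrite lt_min d0.
  move=> n; rewrite ltnS leq_eqVlt => /predU1P[->|/hd].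
    have : Num.min d r <= r by rewrite ge_min lexx orbT.
    rewrite /r; lra.
  have : Num.min d r <= d by rewrite ge_min lexx.
  lra.
exists d => // t xt; have [psi hpsi] := oracle_exists t.
exists (fun n => if (n < b)%N then phi n else psi n) => [n|n ->//].
case: ifPn => // /hd h; have [dn _] := hphi n; split=> //.
have -> : t - ratr (phi n) = (x - ratr (phi n)) - (x - t) by ring.
by apply: le_lt_trans (ler_normB _ _) _; lra.
Qed.

(** Oracles for [x] and [t] that agree on all queries of one run force the same output, which lies
    within 2^-m of both values. *)
Lemma computes_near M x v m : computes_from_oracle M x v ->
  exists2 d : R, 0 < d & forall t v', `|x - t| < d ->
    computes_from_oracle M t v' -> `|v - v'| < 2 * 2 ^- m.
Proof.
move=> hx; have [phi hphi] := oracle_exists x.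
have [y [hy yv]] := hx phi hphi m.
have [b hb] := outputs_local hy.
have [d d0 hd] := oracle_near b hphi.
exists d => // t v' /hd[phi' hphi' /hb hy'] ht.
have [z [/(outputs_uniq hy') <- yv']] := ht phi' hphi' m.
move: yv yv'; rewrite !ltr_norml; lra.
Qed.

End Machines.

(** * Countability of the oracle machines *)

Section Enumeration.

Definition code_symbol k : finType := option (option bool + 'I_k)%type.

Definition code_instr s k : finType :=
  ('I_s * (code_symbol k * 'I_3) * (code_symbol k * 'I_3))%type.

(** States and symbols are finite, so a transition table is a finite function; for fixed sizes the
    codes form a countable type, and so does the sum over all sizes. *)
Definition machine_code (p : nat * nat) : countType :=
  ('I_p.1 * 'I_p.1 * 'I_p.1 * 'I_p.1 *
   {ffun 'I_p.1 * code_symbol p.2 * code_symbol p.2 -> code_instr p.1 p.2})%type.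

Definition decode_move (i : 'I_3) : move :=
  match val i with 0%N => MoveLeft | 1%N => Stay | _ => MoveRight end.

Definition encode_move (d : move) : 'I_3 :=
  match d with
  | MoveLeft => inord 0 | Stay => inord 1 | MoveRight => inord 2
  end.

Lemma encode_moveK : cancel encode_move decode_move.
Proof. by case; rewrite /decode_move /= inordK. Qed.

Definition decode_machine (c : {p : nat * nat & machine_code p}) : oracle_TM :=
  let: existT p (s, q, a, h, f) := c in
  @OracleTM p.1 p.2 s q a h (fun st x y =>
    let: (q', (x', d), (y', e)) := f (st, x, y) in
    (q', (x', decode_move d), (y', decode_move e))).

Lemma decode_machine_surj (M : oracle_TM) : exists c, decode_machine c = M.
Proof.
case: M => n k s q a h f.
pose g : {ffun 'I_n * code_symbol k * code_symbol k -> code_instr n k} :=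
  [ffun u => let: (q', (x', d), (y', e)) := f u.1.1 u.1.2 u.2 in
   (q', (x', encode_move d), (y', encode_move e))].
exists (existT machine_code (n, k) (s, q, a, h, g)); rewrite /decode_machine/=.
congr OracleTM; apply/funext => st; apply/funext => x; apply/funext => y.
by rewrite /g ffunE /=; case: (f st x y) => -[q' [x' d]] [y' e]; rewrite !encode_moveK.
Qed.

Lemma machine_enum : exists f : nat -> option oracle_TM,
  forall M, exists n, f n = Some M.
Proof.
exists (omap decode_machine \o unpickle) => M.
have [c <-] := decode_machine_surj M.
by exists (pickle c); rewrite /= pickleK.
Qed.

End Enumeration.

(** * A starting point with finite Brjuno sum *)

Section Construction.
Context {R : realType}.
Implicit Types x l r c : R.

(** In p^2 = 5 q^2 the 5-adic valuations of the two sides have different parities. *)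
Lemma sqrt5_irrational : ~ rational (Num.sqrt 5 : R).
Proof.
move=> [q _ hq].
have : q ^+ 2 = 5.
  by apply: (fmorph_inj (@ratr R)); rewrite rmorphXn/= hq sqr_sqrtr// ratr_nat.
rewrite -{1}(divq_num_den q) expr_div_n => /(canRL (divfK _)) h.
have {}h : numq q ^+ 2 = 5 * denq q ^+ 2.
  apply: (@intr_inj rat); rewrite [RHS]rmorphM/= !rmorphXn/=; apply: h.
  by rewrite expf_neq0// intr_eq0 denq_neq0.
move: h => /(congr1 absz); rewrite abszM !abszX.
have d0 : (0 < `|denq q|)%N by rewrite absz_gt0 denq_neq0.
have [->|] := posnP `|numq q|%N; first by case: (`|denq q|%N) d0.
move=> n0 /(congr1 (logn 5)); rewrite lognM ?expn_gt0 ?d0// !lognX (logn_prime 5 (isT : prime 5))//=.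
by move=> /(congr1 odd); rewrite oddD !oddM.
Qed.

(** The witness (sqrt 5 - 1) / 2 has all digits 1 and is fixed by the Gauss map, so the series is a
    constant times the bounded sum of orbit products. *)
Lemma exists_finite_Phi : exists2 x : R, irr01 x & (Phi x < +oo)%E.
Proof.
pose s : R := Num.sqrt 5; have s2 : s ^+ 2 = 5 by rewrite sqr_sqrtr.
have s0 : 0 <= s by exact: sqrtr_ge0.
pose x : R := (s - 1) / 2.
have x01 : 0 < x < 1 by rewrite /x; nra.
have hx : irr01 x.
  split=> // -[q _ hq]; apply: sqrt5_irrational; exists (2 * q + 1) => //.
  by rewrite rmorphD rmorphM/= hq ratr_nat rmorph1 -/s /x; field.
have gx : gauss_map x = x.
  rewrite -[in LHS](_ : (1%N%:R + x)^-1 = x) ?gauss_branchK//; first by move: x01; lra.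
  have x10 : 1 + x != 0 by rewrite gt_eqF//; move: x01; lra.
  apply: (mulfI x10); rewrite mulfV//; rewrite /x; nra.
exists x => //; have ox n : gauss_orbit x n = x by elim: n => //= n ->.
apply: (proj1 (@fine_Phi_le _ x (4 * ln x^-1) hx _)).
move=> n; rewrite /brjuno_sum; under eq_bigr do rewrite brjuno_termE ox.
rewrite -mulr_suml ler_wpM2r ?sum_orbit_prod_le//.
exact/ln_ge0/ltW/invr_gt1_itv.
Qed.

End Construction.

(** * Defeating one machine at a time on nested intervals *)

Section Diagonalization.
Context {R : realType}.
Implicit Types x t l r c d e : R.

Lemma pow2V_small e : 0 < e -> exists m : nat, 2 ^- m <= e.
Proof.
move=> e0; exists (Num.truncn e^-1).+1.
rewrite -[leRHS]invrK lef_pV2 ?posrE ?exprn_gt0 ?invr_gt0//.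
apply: le_trans (ltW (truncnS_gt _)) _.
by rewrite -natrX ler_nat ltnW// ltn_expl.
Qed.

Lemma small_radius x l r d (q : rat) : irr01 x -> l < x < r -> 0 < d ->
  exists s : R, [/\ 0 < s, l < x - s, x + s < r, s < d &
    ~ (x - s <= ratr q <= x + s)].
Proof.
move=> [_ ix] /andP[lx xr] d0.
have q0 : 0 < `|x - ratr q|.
  by rewrite normr_gt0 subr_eq0; apply/eqP => xq; apply: ix; rewrite xq; exists q.
pose s := Num.min (Num.min (x - l) (r - x)) (Num.min d `|x - ratr q|).
have s0 : 0 < s by rewrite !lt_min q0 d0 !subr_gt0 lx xr.
have : s <= s by [].
rewrite {2}/s !le_min => /andP[/andP[s1 s2] /andP[s3 s4]].
exists (s / 2); split; try lra.
move=> hq; have : `|x - ratr q| <= s / 2 by rewrite ler_norml; lra.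
by lra.
Qed.

Definition stage : Type := (R * R * R * R)%type.

(* [(l, r, c, x)]: the limit will lie in [[l, r]] and satisfy [Phi <= c];
   the point [x] witnesses that this is still possible. *)
Definition valid (p : stage) : Prop :=
  let: (l, r, c, x) := p in
  [/\ irr01 x, l < x < r, (Phi x < +oo)%E & fine (Phi x) < c].

(** The exclusions hold on the whole closed interval, so the limit point inherits them. Removing one
    rational [q] per stage makes the limit irrational; [M] is optional because the enumeration of
    machines may have gaps. *)
Definition refines (e : R) (q : rat) (M : option oracle_TM) (p p' : stage) : Prop :=
  let: (l, r, c, x) := p in let: (l', r', c', x') := p' in
  [/\ l <= l', r' <= r, c' <= c & r' - l' <= e] /\
  forall t, l' <= t <= r' -> t <> ratr q /\
    (irr01 t -> (Phi t < +oo)%E -> fine (Phi t) <= c' ->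
     forall N, M = Some N -> ~ computes_from_oracle N t (fine (Phi t))).

Lemma refine_unless_computed e q M l r c x : 0 < e -> valid (l, r, c, x) ->
  (forall t, irr01 t -> l < t < r -> (Phi t < +oo)%E -> fine (Phi t) < c ->
     forall N, M = Some N -> ~ computes_from_oracle N t (fine (Phi t))) ->
  exists2 p', valid p' & refines e q M (l, r, c, x) p'.
Proof.
move=> e0 [hx lxr fx xc] hM.
have e20 : 0 < e / 2 by rewrite divr_gt0.
have [s [s0 s1 s2 s3 sq]] := small_radius q hx lxr e20.
(* The midpoint is a new bound strictly below [c], so the weak inequality at the limit still implies
   the strict one asked for by [hM]. *)
exists (x - s, x + s, (fine (Phi x) + c) / 2, x); first by split => //; lra.
split; first by split; lra.
move=> t ht; split; first by move=> tq; rewrite -tq in sq.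
move=> it ft tc; apply: hM => //; lra.
Qed.

(** Near [y], any two values computed by [N] differ from that at [y] by less than g/16, while around
    the jump point [z] the function exceeds its value at [y] by more than g/16. The bound [c] is
    kept, since the jump is less than g. *)
Lemma refine_computed e q (N : oracle_TM) l r c x y : 0 < e ->
  irr01 y -> l < y < r -> (Phi y < +oo)%E -> fine (Phi y) < c ->
  computes_from_oracle N y (fine (Phi y)) ->
  exists2 p', valid p' & refines e q (Some N) (l, r, c, x) p'.
Proof.
move=> e0 hy /andP[ly yr] fy yc hN.
pose g := c - fine (Phi y); have g0 : 0 < g by rewrite subr_gt0.
have g32 : 0 < g / 32 by rewrite divr_gt0.
have [m hm] := pow2V_small g32.
have [d d0 hd] := computes_near m hN.
(* One half of [d] is spent on reaching [z] from [y], the other half, in [d3], on the interval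
   around [z]. *)
pose d1 := Num.min (d / 2) (Num.min (y - l) (r - y)).
have d10 : 0 < d1 by rewrite !lt_min !subr_gt0 ly yr divr_gt0.
have [z [hz]] := Phi_jump hy fy g0 d10.
rewrite !lt_min => /andP[yz /andP[yz1 yz2]] [n hn] fz zc.
have gap : 0 < brjuno_sum z n - (fine (Phi y) + g / 16) by rewrite subr_gt0.
have [d2 d20 hd2] := brjuno_sum_near n hz gap.
have lzr : l < z < r by move: yz1 yz2; rewrite !ltr_norml; lra.
pose d3 := Num.min (Num.min (d / 2) d2) (e / 2).
have d30 : 0 < d3 by rewrite !lt_min d20 !divr_gt0.
have [s [s0 s1 s2]] := small_radius q hz lzr d30.
rewrite !lt_min => /andP[/andP[s3 s4] s5] sq.
exists (z - s, z + s, c, z); first by split => //; [lra|rewrite /g in zc; lra].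
split; first by split; lra.
move=> t ht; split; first by move=> tq; rewrite -tq in sq.
have zt : `|z - t| <= s by rewrite ler_norml; lra.
move=> it ft tc K [<-] hK.
have yt : `|y - t| < d.
  by have := ler_distD z y t; lra.
have := hd _ _ yt hK; have := hd2 t (le_lt_trans zt s4).
have := brjuno_sum_le_fine n it ft; rewrite !ltr_norml.
have := exprn_gt0 m (ltr0Sn R 1); lra.
Qed.

Lemma refine e q M p : 0 < e -> valid p ->
  exists2 p', valid p' & refines e q M p p'.
Proof.
case: p => [[[l r] c] x] e0 hp.
have [[y [N [hy lyr fy yc [MN hN]]]]|h] := pselect (exists y N,
    [/\ irr01 y, l < y < r, (Phi y < +oo)%E, fine (Phi y) < c &
     M = Some N /\ computes_from_oracle N y (fine (Phi y))]).
  by rewrite MN; exact: (@refine_computed _ _ _ _ _ _ _ y).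
apply: refine_unless_computed => // t it ltr ft tc N MN hN.
by apply: h; exists t, N.
Qed.

Lemma exists_chain (e : nat -> R) (q : nat -> rat) (M : nat -> option oracle_TM) :
  (forall n, 0 < e n) ->
  exists p : nat -> stage,
    [/\ (p 0%N).1.1 = (0, 1), forall n, valid (p n) &
      forall n, refines (e n) (q n) (M n) (p n) (p n.+1)].
Proof.
move=> e0; have [x hx fx] := @exists_finite_Phi R.
(* Validity is a premise under the existential so that [choice] yields a total function; an invalid
   stage is returned unchanged. *)
have next (np : nat * stage) : exists p', valid np.2 ->
    valid p' /\ refines (e np.1) (q np.1) (M np.1) np.2 p'.
  have [hp|hp] := pselect (valid np.2); last by exists np.2.
  by have [p' hp' hr] := refine (q np.1) (M np.1) (e0 np.1) hp; exists p'.
have [F hF] := choice next.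
pose p := fix p n := if n is k.+1 then F (k, p k) else (0, 1, fine (Phi x) + 1, x).
have v0 : valid (p 0%N) by have [x01 _] := hx; split=> //; lra.
have vp n : valid (p n) by elim: n => // n /(hF (n, p n))[].
by exists p; split=> // n; have [] := hF (n, p n) (vp n).
Qed.

End Diagonalization.

(** * The limit point and the final argument *)

Section Limit.
Context {R : realType}.

Lemma nested_intervals (l r : nat -> R) : (forall n, l n <= l n.+1) ->
  (forall n, r n.+1 <= r n) -> (forall n, l n <= r n) ->
  exists t, forall n, l n <= t <= r n.
Proof.
move=> hl hr hlr; have {}hl m n : (m <= n)%N -> l m <= l n.
  by move=> /subnK <-; elim: (n - m)%N => // k IH; rewrite addSn (le_trans IH).
have {}hr m n : (m <= n)%N -> r n <= r m.
  by move=> /subnK <-; elim: (n - m)%N => // k IH; rewrite addSn (le_trans (hr _)).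
have lr m n : l m <= r n.
  apply: le_trans (hl m (maxn m n) _) (le_trans (hlr _) (hr _ _ _)).
    exact: leq_maxl.
  exact: leq_maxr.
exists (sup (range l)) => n; apply/andP; split.
  by apply: ub_le_sup; [exists (r 0%N) => _ [m _ <-]|exists n].
by apply: ge_sup; [exists (l 0%N), 0%N|move=> _ [m _ <-]].
Qed.

End Limit.

Theorem theorem2p18 (R : realType) :
  exists theta : R,
    [/\ 0 <= theta < 1,
        (Phi theta < +oo)%E
      & ~ exists M : oracle_TM, computes_from_oracle M theta (fine (Phi theta))].
Proof.
have [f hf] := machine_enum.
pose e n : R := n.+1%:R^-1; pose q n : rat := odflt 0 (unpickle n).
have e0 n : 0 < e n by rewrite invr_gt0.
have [p [p0 hp hr]] := exists_chain q f e0.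
pose l n := (p n).1.1.1; pose r n := (p n).1.1.2; pose c n := (p n).1.2.
pose x n := (p n).2.
have pE n : p n = (l n, r n, c n, x n) by rewrite /l /r /c /x; case: (p n) => -[[]].
have {}hp n : [/\ irr01 (x n), l n < x n < r n, (Phi (x n) < +oo)%E
    & fine (Phi (x n)) < c n] by have := hp n; rewrite pE.
have {}hr n : refines (e n) (q n) (f n) (l n, r n, c n, x n)
    (l n.+1, r n.+1, c n.+1, x n.+1) by rewrite -!pE.
have [theta ht] : exists t, forall n, l n <= t <= r n.
  apply: nested_intervals => n.
  - by have [[]] := hr n.
  - by have [[]] := hr n.
  - by have [_ /andP[h1 h2] _ _] := hp n; exact/ltW/(lt_trans h1).
have cS m k : c (k + m)%N <= c m.
  by elim: k => // k IH; rewrite addSn; have [[_ _ h _] _] := hr (k + m)%N; exact: le_trans IH.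
have itheta : ~ rational theta.
  move=> [a _ ha]; have [_ /(_ _ (ht _))[]] := hr (pickle a).
  by rewrite -ha /q pickleK.
have htheta : irr01 theta.
  split=> //; have := ht 0%N; rewrite /l /r p0/= !le_eqVlt.
  case/andP => /predU1P[t0|->] /predU1P[t1|->] //; exfalso; apply: itheta.
  - by rewrite -t0; exists 0; rewrite ?rmorph0.
  - by rewrite -t0; exists 0; rewrite ?rmorph0.
  - by rewrite t1; exists 1; rewrite ?rmorph1.
(* A partial sum above [c n] would stay above it, by continuity, at a late witness [x m.+1], whose
   Phi is below [c m.+1 <= c n]. *)
have bound n k : brjuno_sum theta k <= c n.
  rewrite leNgt; apply/negP; rewrite -subr_gt0 => gap.
  have [d d0 hd] := brjuno_sum_near k htheta gap.
  (* The first summand makes the interval shorter than [d]; the second makes the stage later than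
     [n]. *)
  pose m := (Num.truncn d^-1 + n)%N.
  have em : e m < d.
    rewrite /e -[ltRHS]invrK ltf_pV2 ?posrE ?invr_gt0//.
    by apply: lt_le_trans (truncnS_gt _) _; rewrite ler_nat ltnS leq_addr.
  have [[_ _ _ lr] _] := hr m; have [hx lxr fx xc] := hp m.+1.
  have /hd : `|theta - x m.+1| < d.
    by rewrite ltr_norml; have := ht m.+1; move: lxr; lra.
  have := brjuno_sum_le_fine k hx fx; have := cS n (Num.truncn d^-1).+1.
  rewrite addSn -/m ltr_norml; lra.
have [ft _] := fine_Phi_le htheta (bound 0%N).
exists theta; split=> //; first by have [/andP[/ltW-> ->]] := htheta.
move=> [M hM]; have [n fn] := hf M.
have [_ /(_ _ (ht _))[_ /(_ htheta ft)]] := hr n.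
by have [_ tc] := fine_Phi_le htheta (bound n.+1); move=> /(_ tc M fn).
Qed.
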